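(* For every non-empty finite set $P=\{p_1,\dots,p_l\}$ of primes there exists a network $\mathcal{N}$ such that $P(\mathcal{N},1)=P$ and $P(\mathcal{N},2)=\mathbb{P}$. That is, for every finite field $F$: $\mathcal{N}$ has a scalar linear network coding solution over $F$ if and only if $\mathrm{char}(F)\in P$, and $\mathcal{N}$ has a $2$-dimensional vector linear network coding solution over every finite field $F$.
   Context: A network is a finite directed acyclic multigraph whose nodes are partitioned into sources (no incoming edges), terminals (no outgoing edges) and intermediate nodes; each terminal demands the messages of a specified set of sources. For a positive integer $d$ and a finite field $F$, a $d$-dimensional vector linear network code (VLNC) over $F$ works as follows: each source $s$ generates a message $x_s\in F^d$ (messages of different sources are independent and arbitrary); each edge $e$ carries a vector $y_e\in F^d$, where $y_e=Ax_s$ for some $d\times d$ matrix $A$ over $F$ if the tail of $e$ is a source $s$, and $y_e=\sum_{e'} A_{e',e}y_{e'}$ (sum over edges $e'$ entering the tail of $e$, with $d\times d$ matrices $A_{e',e}$ over $F$) if the tail of $e$ is an intermediate node; each terminal $t$ computes vectors of the form $\sum_{e} B_e y_e$ (sum over edges $e$ entering $t$, with fixed $d\times d$ matrices $B_e$). The code is a $d$-dimensional VLNC solution over $F$ if for all choices of source messages every terminal computes each of its demanded messages. A $1$-dimensional VLNC solution is a scalar linear network coding (SLNC) solution. $\mathbb{P}$ is the set of all primes. For a network $\mathcal{N}$, a positive integer $d$ and a set $S$ of primes, we write $P(\mathcal{N},d)=S$ to mean: for every finite field $F$, $\mathcal{N}$ has a $d$-dimensional VLNC solution over $F$ if and only if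 the characteristic of $F$ belongs to $S$. *)

(* Defs.v *)
From HB Require Import structures.
From mathcomp Require Import all_boot all_order all_algebra.
Set Implicit Arguments. Unset Strict Implicit. Unset Printing Implicit Defensive.
Import GRing.Theory.
Local Open Scope ring_scope.

(* A network: nodes 'I_nn, edges 'I_ne (multigraph: parallel edges allowed),
   each edge e goes from [tail N e] to [head N e].  [is_src] / [is_term] mark
   sources / terminals (other nodes are intermediate); [demand t s] means
   terminal t demands the message of source s. *)
Record network := Network {
  nn : nat;
  ne : nat;
  tail : 'I_ne -> 'I_nn;
  head : 'I_ne -> 'I_nn;
  is_src : pred 'I_nn;
  is_term : pred 'I_nn;
  demand : 'I_nn -> 'I_nn -> bool
}.
Arguments tail n _ : clear implicits.
Arguments head n _ : clear implicits.
Arguments is_src n _ : clear implicits.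
Arguments is_term n _ : clear implicits.
Arguments demand n _ _ : clear implicits.

Definition network_wf (N : network) : Prop :=
  [/\ exists r : 'I_(nn N) -> nat, forall e, (r (tail N e) < r (head N e))%N,
      forall v, ~~ (is_src N v && is_term N v),
      forall e, ~~ is_src N (head N e),
      forall e, ~~ is_term N (tail N e)
    & forall t s, demand N t s -> is_term N t && is_src N s].

(* d-dimensional vector linear network code solution over F.
   A e : local encoding matrix of an edge e leaving a source;
   C e' e : matrix A_{e',e} for e' entering the tail of e (intermediate);
   B t s e : decoding matrix used by terminal t, for demanded source s,
             on incoming edge e.
   The edge vectors y are determined by the messages x (acyclicity);
   every terminal must recover each demanded message for every choice
   of messages. *)
Definition vlnc_solution (N : network) (F : fieldType) (d : nat) : Prop :=
  exists (A : 'I_(ne N) -> 'M[F]_d)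
         (C : 'I_(ne N) -> 'I_(ne N) -> 'M[F]_d)
         (B : 'I_(nn N) -> 'I_(nn N) -> 'I_(ne N) -> 'M[F]_d),
  forall (x : 'I_(nn N) -> 'cV[F]_d) (y : 'I_(ne N) -> 'cV[F]_d),
    (forall e, is_src N (tail N e) -> y e = A e *m x (tail N e)) ->
    (forall e, ~~ is_src N (tail N e) ->
        y e = \sum_(e' | head N e' == tail N e) C e' e *m y e') ->
    forall t s, demand N t s ->
      \sum_(e | head N e == t) B t s e *m y e = x s.

(* Main.v *)
(* The network is built around Pappus' theorem.  Three bottlenecks U_i (each
   carrying in addition a private masking message o_i) and three bottlenecks
   V_j carry combinations of x_0, x_1, x_2; for (i, j) <> (0, 0) a terminal
   forces U_i and V_j to be proportional off the coordinate x_(i+j).  Over a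
   field these eight conditions imply the ninth, for (i, j) = (0, 0), so that a
   terminal receiving U_0, V_0 and x_0 cannot isolate x_1.  Over 2 x 2 matrices
   the ninth condition fails by a commutator, which can be made invertible, and
   then this terminal recovers x_1.  The remaining bottlenecks, equivalent to
   s = x_1 + z_0 + ... + z_m and e_k = s - z_k, give the terminal another way to
   get x_1, as the sum of the e_k, exactly when m = 0 in the field.  Take for m
   the product of the primes in P. *)
Require Import Defs.
From mathcomp Require Import all_boot all_order all_algebra.
From mathcomp Require Import ring.
Set Implicit Arguments. Unset Strict Implicit. Unset Printing Implicit Defensive.
Import GRing.Theory.
Local Open Scope ring_scope.

(** * Networks on arbitrary finite types of nodes and edges *)

Section FiniteNetwork.

Variables (V E : finType) (tl hd : E -> V) (src term : pred V).
Variable dem : V -> V -> bool.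

Definition fin_network : network :=
  @Network #|V| #|E|
    (fun e => enum_rank (tl (enum_val e)))
    (fun e => enum_rank (hd (enum_val e)))
    (fun v => src (enum_val v)) (fun v => term (enum_val v))
    (fun t s => dem (enum_val t) (enum_val s)).

Lemma fin_network_wf (r : V -> nat) :
    (forall e, r (tl e) < r (hd e))%N -> (forall v, ~~ (src v && term v)) ->
    (forall e, ~~ src (hd e)) -> (forall e, ~~ term (tl e)) ->
    (forall t s, dem t s -> term t && src s) ->
  network_wf fin_network.
Proof.
move=> rP st sh tt dP; split=> /=.
- by exists (fun v => r (enum_val v)) => e; rewrite !enum_rankK.
- by move=> v; apply: st.
- by move=> e; rewrite enum_rankK.
- by move=> e; rewrite enum_rankK.
- by move=> t s; apply: dP.
Qed.

Definition fin_solution (F : fieldType) (d : nat) : Prop :=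
  exists (A : E -> 'M[F]_d) (C : E -> E -> 'M[F]_d)
         (B : V -> V -> E -> 'M[F]_d),
  forall (x : V -> 'cV[F]_d) (y : E -> 'cV[F]_d),
    (forall e, src (tl e) -> y e = A e *m x (tl e)) ->
    (forall e, ~~ src (tl e) ->
        y e = \sum_(e' | hd e' == tl e) C e' e *m y e') ->
    forall t s, dem t s -> \sum_(e | hd e == t) B t s e *m y e = x s.

Lemma fin_network_solution F d :
  vlnc_solution fin_network F d <-> fin_solution F d.
Proof.
have sum_rank (W : nmodType) (Q : pred 'I_#|E|) (G : 'I_#|E| -> W) :
    \sum_(e | Q e) G e = \sum_(e | Q (enum_rank e)) G (enum_rank e).
  by rewrite (reindex enum_rank) //; apply/onW_bij/enum_rank_bij.
split=> -[A [C [B sol]]].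
- exists (A \o enum_rank), (fun e' e => C (enum_rank e') (enum_rank e)).
  exists (fun t s e => B (enum_rank t) (enum_rank s) (enum_rank e)).
  move=> x y yA yC t s dts.
  have := sol (x \o enum_val) (y \o enum_val) _ _ (enum_rank t) (enum_rank s).
  rewrite /= !enum_rankK => <- //.
  + rewrite [RHS]sum_rank /=; apply: eq_big => e; rewrite enum_rankK //.
    by rewrite (inj_eq enum_rank_inj).
  + by move=> e; rewrite !enum_rankK => /yA ->; rewrite /= enum_valK.
  + move=> e; rewrite !enum_rankK => /yC ->.
    rewrite [RHS]sum_rank /=; apply: eq_big => e'.
      by rewrite enum_rankK (inj_eq enum_rank_inj).
    by rewrite enum_rankK enum_valK.
- exists (A \o enum_val), (fun e' e => C (enum_val e') (enum_val e)).
  exists (fun t s e => B (enum_val t) (enum_val s) (enum_val e)).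
  move=> x y yA yC t s dts.
  have := sol (x \o enum_rank) (y \o enum_rank) _ _ _ _ dts.
  rewrite /= !enum_valK => <- //.
  + rewrite sum_rank /=; apply: eq_big => e; rewrite enum_rankK //.
    by rewrite (can2_eq enum_rankK enum_valK).
  + by move=> e se; rewrite yA /= !enum_rankK.
  + move=> e se; rewrite yC /= !enum_rankK //.
    rewrite sum_rank /=; apply: eq_big => e'; rewrite enum_rankK //.
    by rewrite (inj_eq enum_rank_inj).
Qed.

End FiniteNetwork.

(** * One-layer networks, whose solutions amount to matrix factorizations *)

Section OneLayerCode.

Variables (I J T : finType) (S : J -> pred I) (R : T -> pred J).
Variables (K : T -> pred I) (g : T -> I).

(* [D] and [M] factor the demand matrix, up to the columns in [K t], which
   the terminal [t] knows and can cancel. *)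
Definition one_layer_code (A : nzRingType) : Prop :=
  exists (M : J -> I -> A) (D : T -> J -> A),
    (forall j i, ~~ S j i -> M j i = 0) /\
    (forall t i, ~~ K t i ->
       \sum_(j | R t j) D t j * M j i = (i == g t)%:R).

(* Each [j : J] is a bottleneck edge from the first to the second copy of [J];
   [None] is a sink without demands absorbing the edges excluded by [S], [R]
   and [K]. *)
Let node : finType := (I + J + J + option T)%type.
Let edge : finType := (I * J + J + J * T + I * T)%type.

Let nsrc (i : I) : node := inl (inl (inl i)).
Let nin (j : J) : node := inl (inl (inr j)).
Let nout (j : J) : node := inl (inr j).
Let nterm (t : option T) : node := inr t.

Let tl (e : edge) : node :=
  match e with
  | inl (inl (inl p)) => nsrc p.1
  | inl (inl (inr j)) => nin j
  | inl (inr p) => nout p.1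
  | inr p => nsrc p.1
  end.

Let hd (e : edge) : node :=
  match e with
  | inl (inl (inl p)) => if S p.2 p.1 then nin p.2 else nterm None
  | inl (inl (inr j)) => nout j
  | inl (inr p) => nterm (if R p.2 p.1 then Some p.2 else None)
  | inr p => nterm (if K p.2 p.1 then Some p.2 else None)
  end.

Let src (v : node) := if v is inl (inl (inl _)) then true else false.
Let term (v : node) := if v is inr _ then true else false.
Let dem (t s : node) :=
  match t, s with
  | inr (Some t), inl (inl (inl i)) => i == g t
  | _, _ => false
  end.

Definition one_layer_network := fin_network tl hd src term dem.

Lemma one_layer_network_wf : network_wf one_layer_network.
Proof.
pose r (v : node) : nat :=
  match v with
  | inl (inl (inl _)) => 0 | inl (inl (inr _)) => 1
  | inl (inr _) => 2 | inr _ => 3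
  end.
apply: (@fin_network_wf _ _ _ _ _ _ _ r).
- by move=> [[[[i j]|j]|[j t]]|[i t]] //=; case: (S j i).
- by move=> [[[]|]|].
- by move=> [[[[i j]|j]|[j t]]|[i t]] //=; case: (S j i).
- by move=> [[[[i j]|j]|[j t]]|[i t]].
- by move=> [[[?|?]|?]|[t|]] [[[?|?]|?]|?].
Qed.

Let sum_snd (W : nmodType) (X Y : finType) (Q : pred X) (y : Y)
    (P : pred (X * Y)) (G : X * Y -> W) :
  (forall p, P p = (p.2 == y) && Q p.1) ->
  \sum_(p | P p) G p = \sum_(x | Q x) G (x, y).
Proof.
move=> PE; rewrite (reindex_onto (fun x => (x, y)) fst) /=.
  by apply: eq_bigl => x; rewrite PE /= !eqxx andbT.
by case=> x y'; rewrite PE /= => /andP[/eqP ->].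
Qed.

Let sum_in (W : nmodType) (j : J) (G : edge -> W) :
  \sum_(e | hd e == nin j) G e = \sum_(i | S j i) G (inl (inl (inl (i, j)))).
Proof.
rewrite !big_sumType /= !big_pred0_eq !addr0.
apply: sum_snd => -[i j'] /=; case: (eqVneq j' j) => [->|ne].
  by case: (S j i); rewrite ?eqxx.
by case: (S j' i) => //=; apply/negP => /eqP[/eqP]; apply/negP.
Qed.

Let sum_out (W : nmodType) (j : J) (G : edge -> W) :
  \sum_(e | hd e == nout j) G e = G (inl (inl (inr j))).
Proof.
rewrite !big_sumType /= [X in X + _ + _ + _]big_pred0 ?add0r => [|p];
  last by case: (S _ _).
rewrite !big_pred0_eq !addr0.
by rewrite (eq_bigl (pred1 j)) ?big_pred1_eq.
Qed.

Let sum_term (W : nmodType) (t : T) (G : edge -> W) :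
  \sum_(e | hd e == nterm (Some t)) G e =
  \sum_(j | R t j) G (inl (inr (j, t))) + \sum_(i | K t i) G (inr (i, t)).
Proof.
rewrite !big_sumType /=.
rewrite [X in X + _ + _ + _]big_pred0 ?add0r; last by move=> p; case: (S _ _).
rewrite big_pred0 // add0r; congr (_ + _); apply: sum_snd => -[z t'] /=.
  case: (eqVneq t' t) => [->|ne]; first by case: (R t z); rewrite ?eqxx.
  by case: (R t' z) => //=; apply/negP => /eqP[/eqP]; apply/negP.
case: (eqVneq t' t) => [->|ne]; first by case: (K t z); rewrite ?eqxx.
by case: (K t' z) => //=; apply/negP => /eqP[/eqP]; apply/negP.
Qed.

(** Let only a source [i] outside [K t] send a nonzero message: the direct edges into [t] from known
    sources then carry zero, so the bottlenecks alone must produce column [i]. *)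
Let code_of_solution (F : fieldType) d :
  fin_solution tl hd src dem F d.+1 -> one_layer_code 'M[F]_d.+1.
Proof.
move=> [A [C [B sol]]].
pose ein i j : edge := inl (inl (inl (i, j))).
pose emid j : edge := inl (inl (inr j)).
pose eout j t : edge := inl (inr (j, t)).
pose M j i := if S j i then C (ein i j) (emid j) *m A (ein i j) else 0.
pose D t j := B (nterm (Some t)) (nsrc (g t)) (eout j t)
                *m C (emid j) (eout j t).
exists M, D; split=> [j i /negbTE Sji|t i Kti]; first by rewrite /M Sji.
suff eqv (v : 'cV[F]_d.+1) :
    (\sum_(j | R t j) D t j * M j i) *m v = (i == g t)%:R *m v.
  apply/matrixP => a b; have := eqv (delta_mx b 0).
  by rewrite -!colE => /matrixP/(_ a 0); rewrite [LHS]mxE [RHS]mxE.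
pose x (w : node) : 'cV[F]_d.+1 := if w == nsrc i then v else 0.
pose ymid j := M j i *m v.
pose y (e : edge) : 'cV[F]_d.+1 :=
  match e with
  | inl (inl (inl p)) => A e *m x (nsrc p.1)
  | inl (inl (inr j)) => ymid j
  | inl (inr p) => C (emid p.1) e *m ymid p.1
  | inr p => A e *m x (nsrc p.1)
  end.
have xE i' : x (nsrc i') = if i' == i then v else 0 by [].
have yA e : src (tl e) -> y e = A e *m x (tl e).
  by case: e => [[[?|?]|?]|?].
have yC e : ~~ src (tl e) ->
    y e = \sum_(e' | hd e' == tl e) C e' e *m y e'.
  case: e => [[[?|j]|[j t']]|?] //= _; last by rewrite sum_out.
  rewrite sum_in /= /ymid /M; case Sji: (S j i).
    rewrite (bigD1 i) //= xE eqxx big1 ?addr0 ?mulmxA // => i' /andP[_ ne].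
    by rewrite xE (negPf ne) !mulmx0.
  rewrite mul0mx big1 // => i' Sji'; rewrite xE.
  by case: eqP Sji' => [->|_ _]; rewrite ?Sji // !mulmx0.
have := sol x y yA yC (nterm (Some t)) (nsrc (g t)) (eqxx _).
rewrite sum_term [X in _ + X]big1 ?addr0 => [solt|i' Kti'].
  rewrite mulmx_suml (eq_bigr
    (fun j => B (nterm (Some t)) (nsrc (g t)) (eout j t) *m y (eout j t))).
    rewrite solt xE eq_sym; case: eqP => _; first by rewrite mul1mx.
    by rewrite mul0mx.
  by move=> j _; rewrite /= !mulmxA.
rewrite /= xE; case: eqP Kti' => [->|_ _]; first by rewrite (negPf Kti).
by rewrite !mulmx0.
Qed.

(** Sources send their messages uncoded, bottlenecks apply [M], terminals apply [D], and the direct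
    edges correct the columns in [K t]. *)
Let solution_of_code (F : fieldType) d :
  one_layer_code 'M[F]_d.+1 -> fin_solution tl hd src dem F d.+1.
Proof.
move=> [M [D [MS MD]]].
pose C (e' e : edge) : 'M[F]_d.+1 :=
  if e' is inl (inl (inl p)) then M p.2 p.1 else 1.
pose B (_ _ : node) (e : edge) : 'M[F]_d.+1 :=
  match e with
  | inl (inr p) => D p.2 p.1
  | inr p => (p.1 == g p.2)%:R - \sum_(j | R p.2 j) D p.2 j * M j p.1
  | _ => 0
  end.
exists (fun=> 1), C, B => x y yA yC t s.
case: t => [//|[t|//]] /=; case: s => [[[i|//]|//]|//] /= /eqP ->.
have ymid j : y (inl (inl (inr j))) = \sum_i M j i *m x (nsrc i).
  rewrite yC // sum_in /= [RHS](bigID (S j)) /= [X in _ + X]big1 ?addr0.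
    by apply: eq_bigr => i' _; rewrite yA ?mul1mx.
  by move=> i' nS; rewrite MS // mul0mx.
have yout j : y (inl (inr (j, t))) = \sum_i M j i *m x (nsrc i).
  by rewrite yC // sum_out /= ymid mul1mx.
rewrite sum_term /=.
under eq_bigr => j _ do rewrite yout mulmx_sumr.
rewrite exchange_big /=.
under eq_bigr => i' _ do (under eq_bigr => j _ do rewrite mulmxA;
  rewrite -mulmx_suml).
under [X in _ + X]eq_bigr => i' _ do rewrite yA // mul1mx mulmxBl.
rewrite (bigID (K t)) /= addrAC -big_split /=.
rewrite (eq_bigr (fun i' => (i' == g t)%:R *m x (nsrc i'))); last first.
  by move=> i' _; rewrite addrC subrK.
rewrite [X in _ + X](eq_bigr (fun i' => (i' == g t)%:R *m x (nsrc i'))).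
  rewrite -(bigID (K t) xpredT (fun i' => (i' == g t)%:R *m x (nsrc i'))) /=.
  rewrite (bigD1 (g t)) //= eqxx mul1mx big1 ?addr0 // => i' /negPf ->.
  by rewrite mul0mx.
by move=> i' nK; rewrite -[X in _ = X *m _](MD t i' nK).
Qed.

Lemma one_layer_networkP (F : fieldType) d :
  vlnc_solution one_layer_network F d.+1 <-> one_layer_code 'M[F]_d.+1.
Proof.
split=> [/fin_network_solution|code]; first exact: code_of_solution.
exact/fin_network_solution/solution_of_code.
Qed.

End OneLayerCode.

(** * Pappus' theorem in coordinates, with indices modulo 3 *)

Lemma ord3_ind (Q : 'I_3 -> Prop) :
  Q 0 -> Q 1 -> Q (1 + 1) -> forall i, Q i.
Proof.
by move=> Q0 Q1 Q2 [[|[|[|//]]] lt_i];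
  [move: Q0 | move: Q1 | move: Q2]; congr Q; apply: val_inj.
Qed.

(** For k = i + j + 1 and k' = i + j + 2, the left sides of all nine relations multiply to the
    product of all eighteen entries, and so do the right sides; eight relations thus give the ninth
    by cancellation. *)
Lemma pappus (F : fieldType) (u v : 'I_3 -> 'I_3 -> F) :
    (forall i k, u i k != 0) -> (forall j k, v j k != 0) ->
    (forall i j k k', (i, j) != (0, 0) -> k != i + j -> k' != i + j ->
       u i k * v j k' = u i k' * v j k) ->
  u 0 1 * v 0 (1 + 1) = u 0 (1 + 1) * v 0 1.
Proof.
move=> u0 v0 uv.
set a := 1 + 1 in uv *.
have uv01 := uv 0 1 a 0 isT isT isT; have uv02 := uv 0 a 0 1 isT isT isT.
have uv10 := uv 1 0 a 0 isT isT isT; have uv11 := uv 1 1 0 1 isT isT isT.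
have uv12 := uv 1 a 1 a isT isT isT; have uv20 := uv a 0 0 1 isT isT isT.
have uv21 := uv a 1 1 a isT isT isT; have uv22 := uv a a a 0 isT isT isT.
pose c := u 0 a * v 1 0 * (u 0 0 * v a 1) * (u 1 a * v 0 0) * (u 1 0 * v 1 1)
  * (u 1 1 * v a a) * (u a 0 * v 0 1) * (u a 1 * v 1 a) * (u a a * v a 0).
have c0 : c != 0 by rewrite /c !mulf_neq0.
(* [c] collects the other factors of the product of all u_ik and v_jk. *)
apply: (mulfI c0); rewrite [in RHS]/c uv01 uv02 uv10 uv11 uv12 uv20 uv21 uv22.
by rewrite /c; ring.
Qed.

(** * The Pappus network and its codes *)

Section PappusNetwork.

Variable m : nat.

(* Messages x_k, o_i, z_k; bottlenecks U_i, V_j, e_k, s.  [ter_line (i, j)]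
   relates U_i to V_j, [ter_unit (i, k)] makes the coefficient of x_k in U_i
   invertible, and [ter_sum k] forces e_k to be s without z_k, up to scaling. *)
Definition message : finType := ('I_3 + 'I_3 + 'I_m.+1)%type.
Definition bottleneck : finType := ('I_3 + 'I_3 + 'I_m.+1 + unit)%type.
Definition terminal : finType := ('I_3 * 'I_3 + 'I_3 * 'I_3 + 'I_m.+1)%type.

Notation msg_x k := (inl (inl k)).
Notation msg_o i := (inl (inr i)).
Notation msg_z k := (inr k).
Notation bot_u i := (inl (inl (inl i))).
Notation bot_v j := (inl (inl (inr j))).
Notation bot_e k := (inl (inr k)).
Notation bot_s w := (inr w).
Notation ter_line p := (inl (inl p)).
Notation ter_unit p := (inl (inr p)).
Notation ter_sum k := (inr k).

Definition support (b : bottleneck) (a : message) : bool :=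
  match b, a with
  | bot_u _, msg_x _ => true
  | bot_u i, msg_o i' => i' == i
  | bot_v _, msg_x _ => true
  | bot_e _, msg_x k => k == 1
  | bot_e k, msg_z k' => k' != k
  | bot_s _, msg_x k => k == 1
  | bot_s _, msg_z _ => true
  | _, _ => false
  end.

Definition received (t : terminal) (b : bottleneck) : bool :=
  match t, b with
  | ter_line p, bot_u i => i == p.1
  | ter_line p, bot_v j => j == p.2
  | ter_line p, bot_e _ => p == (0, 0)
  | ter_unit p, bot_u i => i == p.1
  | ter_sum k, bot_e k' => k' == k
  | ter_sum _, bot_s _ => true
  | _, _ => false
  end.

Definition known (t : terminal) (a : message) : bool :=
  match t, a with
  | ter_line p, msg_x k => k == p.1 + p.2
  | ter_line p, msg_o i => (p == (0, 0)) && (i == 0)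
  | ter_unit p, _ => a != msg_x p.2
  | _, _ => false
  end.

(** Since o_i occurs in U_i alone, demanding it forces a nonzero weight on U_i, while each x_k with
    k other than i + j has to cancel against V_j. *)
Definition demanded (t : terminal) : message :=
  match t with
  | ter_line p => if p == (0, 0) then msg_x 1 else msg_o p.1
  | ter_unit p => msg_x p.2
  | ter_sum k => msg_z k
  end.

Definition pappus_code := one_layer_code support received known demanded.

Lemma sum_unit (W : nmodType) (f : unit -> W) : \sum_x f x = f tt.
Proof. by rewrite (big_pred1 tt) // => -[]. Qed.

(** This is the coefficient of z_k in the sum of all the e_k'. *)
Lemma sum_neq (A : nzRingType) (k : 'I_m.+1) :
  \sum_(k' < m.+1) (k != k')%:R = m%:R :> A.
Proof.
rewrite -natr_sum -big_mkcond /= sum1_card; congr (_%:R).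
rewrite (@eq_card _ _ (predC1 k)) ?cardC1 ?card_ord // => k'.
by rewrite !inE eq_sym.
Qed.

Lemma received_line (W : nmodType) p (f : bottleneck -> W) :
  \sum_(b | received (ter_line p) b) f b =
  f (bot_u p.1) + f (bot_v p.2)
    + (if p == (0, 0) then \sum_k f (bot_e k) else 0).
Proof.
rewrite !big_sumType /= !big_pred1_eq big_pred0_eq addr0.
by case: ifP => // _; rewrite big_pred0_eq.
Qed.

Lemma received_unit (W : nmodType) p (f : bottleneck -> W) :
  \sum_(b | received (ter_unit p) b) f b = f (bot_u p.1).
Proof.
by rewrite !big_sumType /= big_pred1_eq !big_pred0_eq !addr0.
Qed.

Lemma received_sum (W : nmodType) k (f : bottleneck -> W) :
  \sum_(b | received (ter_sum k) b) f b = f (bot_e k) + f (bot_s tt).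
Proof.
rewrite !big_sumType /= sum_unit big_pred1_eq.
by rewrite !big_pred0_eq !add0r.
Qed.

(* The hypotheses on [du], [dv] and [c] say that terminal (0, 0) can decode. *)
Lemma pappus_code_exists (A : unitRingType) (x y du dv c : A) :
    x \is a GRing.unit -> y \is a GRing.unit ->
    du + dv + c *+ m.+1 = 1 -> du * (x * y) + dv * (y * x) = 0 ->
    c *+ m = 0 ->
  pappus_code A.
Proof.
move=> xU yU duv1 duv2 cm.
pose tab (s : seq (seq A)) (i k : 'I_3) := nth 0 (nth [::] s i) k.
(* Off x_(i+j), row i of [u] is [l i j] times row j of [v], except at (0, 0): there the rows read
   (1, x y) and (1, y x), proportional only if x and y commute. *)
pose u := tab [:: [:: x; 1; x * y]; [:: 1; y; y * x]; [:: 1; 1; 1]].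
pose v := tab [:: [:: 1; 1; y * x]; [:: 1; y; y]; [:: x; 1; x]].
pose l := tab [:: [:: 0; x; 1]; [:: 1; 1; y]; [:: 1; y^-1; x^-1]].
have uU i k : u i k \is a GRing.unit.
  by elim/ord3_ind: i; elim/ord3_ind: k;
     rewrite /u /tab /= ?unitr1 ?unitrMl.
have uvl i j k : (i, j) != (0, 0) -> k != i + j -> u i k = l i j * v j k.
  by elim/ord3_ind: i; elim/ord3_ind: j; elim/ord3_ind: k;
     rewrite /u /v /l /tab //= ?mul1r ?mulr1 ?mulVr.
pose M (b : bottleneck) (a : message) : A :=
  match b, a with
  | bot_u i, msg_x k => u i k
  | bot_v j, msg_x k => v j k
  | _, _ => (support b a)%:R
  end.
(* At (0, 0) every e_k gets weight [c], which adds c (m + 1) to the coefficient of x_1 and c m to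
   that of each z_k. *)
pose D (t : terminal) (b : bottleneck) : A :=
  match t, b with
  | ter_line p, bot_u i => if p == (0, 0) then du else 1
  | ter_line p, bot_v j => if p == (0, 0) then dv else - l p.1 j
  | ter_line p, _ => c
  | ter_unit p, _ => (u p.1 p.2)^-1
  | ter_sum _, bot_s _ => 1
  | ter_sum _, _ => -1
  end.
exists M, D; split.
  by move=> [[[i|j]|k]|[]] [[k'|i']|k'] //= /negPf ->.
move=> [[[i j]|[i k]]|k] a Ka.
- rewrite received_line /=; case: eqP Ka => [[-> ->]|/eqP ij0] /=.
    case: a => [[k|i']|k] /=.
    + elim/ord3_ind: k => //= _; rewrite /u /v /tab /=.
        by rewrite !mulr1 sumr_const card_ord.
      by rewrite mulr0 sumr_const mul0rn addr0.
    + by move=> /negPf ->; rewrite !mulr0 sumr_const mul0rn !addr0.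
    + by rewrite !mulr0 !add0r -mulr_sumr sum_neq mulr_natr.
  rewrite addr0 mul1r mulNr; case: a => [[k|i']|k] /=.
  + by move=> nk; rewrite (uvl i j) // subrr.
  + by rewrite mulr0 subr0.
  + by rewrite mulr0 subr0.
- rewrite received_unit; move: Ka; rewrite negbK => /eqP ->.
  by rewrite /= eqxx mulVr.
- rewrite received_sum /= mulN1r mul1r; case: a {Ka} => [[k'|i']|k'] /=.
  + by rewrite addNr.
  + by rewrite addNr.
  + by rewrite -[inr k' == inr k]/(k' == k); case: (k' == k);
       rewrite ?oppr0 ?add0r ?addNr.
Qed.

(** If m were nonzero, cancelling the z_k at terminal (0, 0) would also cancel x_1 from the e_k.
    Then x_1 would come from U_0 and V_0, which by Pappus are proportional on x_1 and x_2, so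
    cancelling x_2 loses x_1 too. *)
Lemma pappus_code_char (F : fieldType) : pappus_code F -> m%:R = 0 :> F.
Proof.
case=> M [D [MS MD]].
have unitP i k : D (ter_unit (i, k)) (bot_u i) * M (bot_u i) (msg_x k) = 1.
  have := MD (ter_unit (i, k)) (msg_x k).
  by rewrite received_unit /= !eqxx => ->.
have u0 i k : M (bot_u i) (msg_x k) != 0.
  by apply/eqP => u0; move: (unitP i k); rewrite u0 mulr0 => /esym/eqP;
     rewrite oner_eq0.
have line i j : (i, j) != (0, 0) -> exists2 l, l != 0 &
    forall k, k != i + j -> M (bot_u i) (msg_x k) = l * M (bot_v j) (msg_x k).
  move=> /negPf ij0; set p := (i, j) in ij0.
  pose d := D (ter_line p) (bot_u i); pose d' := D (ter_line p) (bot_v j).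
  have lineE a : ~~ known (ter_line p) a ->
      d * M (bot_u i) a + d' * M (bot_v j) a = (a == msg_o i)%:R.
    by move=> /MD; rewrite received_line /= ij0 addr0.
  have d0 : d != 0.
    apply/eqP => d0; have := lineE (msg_o i).
    rewrite /= ij0 eqxx (MS (bot_v j)) // mulr0 addr0 d0 mul0r.
    by move=> /(_ isT)/esym/eqP; rewrite oner_eq0.
  have uE k : k != i + j ->
      M (bot_u i) (msg_x k) = - (d' / d) * M (bot_v j) (msg_x k).
    move=> /(lineE (msg_x k))/= /eqP; rewrite addr_eq0 => /eqP dE.
    by apply: (mulfI d0); rewrite dE; field.
  exists (- (d' / d)) => //; apply/eqP => l0.
  have := u0 i (i + j + 1); rewrite uE ?l0 ?mul0r ?eqxx //.
  by rewrite -subr_eq0 addrAC subrr.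
have v0 j k : M (bot_v j) (msg_x k) != 0.
  have [i ij0 ki] : exists2 i, (i, j) != (0, 0) & k != i + j.
    (* At least one of the two nonzero indices differs from k - j. *)
    have [i i0 ki] : exists2 i : 'I_3, i != 0 & k - j != i.
      case: (eqVneq (k - j) 1) => [->|ne]; last by exists 1.
      by exists (1 + 1).
    exists i; first by rewrite xpair_eqE (negPf i0).
    by rewrite -subr_eq.
  by have [l _ lE] := line i j ij0; have := u0 i k;
     rewrite lE // mulf_eq0 => /norP[].
have /pappus uv00 : forall i j k k', (i, j) != (0, 0) ->
    k != i + j -> k' != i + j ->
    M (bot_u i) (msg_x k) * M (bot_v j) (msg_x k')
    = M (bot_u i) (msg_x k') * M (bot_v j) (msg_x k).
  by move=> i j k k' /line[l _ lE] nk nk'; rewrite !lE //; ring.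
have {}uv00 := uv00 u0 v0.
apply/eqP; apply/negP => /negP m0.
have m_gt0 : (0 < m)%N by case: (m) m0; rewrite ?eqxx.
pose eta k := M (bot_s tt) (msg_z k); pose d k := D (ter_sum k) (bot_e k).
pose d' k := D (ter_sum k) (bot_s tt).
have sumE k a : d k * M (bot_e k) a + d' k * M (bot_s tt) a
    = (a == msg_z k)%:R.
  by rewrite -(MD (ter_sum k) a) // received_sum.
have d'eta k : d' k * eta k = 1.
  by have := sumE k (msg_z k);
     rewrite (MS (bot_e k)) /= ?eqxx // mulr0 add0r.
have eta0 k : eta k != 0.
  by apply/eqP => e0; move/eqP: (d'eta k); rewrite e0 mulr0 eq_sym oner_eq0.
have d'0 k : d' k != 0.
  by apply/eqP => e0; move/eqP: (d'eta k); rewrite e0 mul0r eq_sym oner_eq0.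
have d0 k : d k != 0.
  (* As m > 0 there is a second index; without e_k, nothing would cancel z_k' in s. *)
  have [k' ne] : exists k' : 'I_m.+1, k' != k.
    case: (eqVneq k ord0) => [->|ne]; last by exists ord0; rewrite eq_sym.
    by exists ord_max; rewrite -val_eqE /= -lt0n.
  apply/eqP => dk0; have /eqP := sumE k (msg_z k').
  rewrite dk0 mul0r add0r.
  rewrite (_ : (msg_z k' == msg_z k :> message) = false); last exact: negbTE ne.
  by rewrite mulf_eq0 (negPf (d'0 k)) (negPf (eta0 k')).
have MeE k a : a != msg_z k -> M (bot_e k) a = - (d' k / d k) * M (bot_s tt) a.
  move=> /negPf ne; have /eqP := sumE k a; rewrite ne addr_eq0 => /eqP dE.
  by apply: (mulfI (d0 k)); rewrite dE; field.
pose t0 := ter_line (0, 0) : terminal.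
(* Off z_k, the weighted contribution of e_k to this terminal is - [w k] times s. *)
pose w k := D t0 (bot_e k) * (d' k / d k).
have t0E a : ~~ known t0 a ->
    D t0 (bot_u 0) * M (bot_u 0) a + D t0 (bot_v 0) * M (bot_v 0) a
      + \sum_k D t0 (bot_e k) * M (bot_e k) a = (a == msg_x 1)%:R.
  by move=> /MD; rewrite received_line.
(* Only the e_k with k other than k' contain z_k', so cancelling it makes the other [w k] sum to
   zero. *)
have wz k' : \sum_k w k = w k'.
  have /eqP := t0E (msg_z k') isT.
  rewrite !(MS (bot_u _)) ?(MS (bot_v _)) // !mulr0 !add0r (bigD1 k') //=.
  rewrite (MS (bot_e k')) /= ?eqxx // mulr0 add0r.
  rewrite (eq_bigr (fun k => - eta k' * w k)) => [|k ne].
    rewrite -mulr_sumr mulf_eq0 oppr_eq0 (negPf (eta0 k')) /= => /eqP w0.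
    by rewrite (bigD1 k') //= w0 addr0.
  by rewrite MeE 1?eq_sym // /w /eta; ring.
(* Each [w k'] equals the sum of all [m + 1] of them. *)
have w0 : \sum_k w k = 0.
  set W := \sum_k w k in wz *; have /eqP : W = W *+ m.+1.
    rewrite {1}/W (eq_bigr (fun=> W)) => [|k _]; last by rewrite -wz.
    by rewrite sumr_const card_ord.
  rewrite mulrS -subr_eq0 opprD addNKr oppr_eq0 -mulr_natr mulf_eq0.
  by rewrite (negPf m0) orbF => /eqP.
have uv1 : _ = 1 := t0E (msg_x 1) isT.
have uv2 : _ = 0 := t0E (msg_x (1 + 1)) isT.
rewrite [X in _ + X]big1 ?addr0 in uv2 => [|k _]; last first.
  by rewrite (MS (bot_e k)) ?mulr0.
rewrite (eq_bigr (fun k => - M (bot_s tt) (msg_x 1) * w k)) in uv1 => [|k _];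
  last first.
  by rewrite MeE // /w; ring.
rewrite -mulr_sumr w0 mulr0 addr0 in uv1.
set v2 := M (bot_v 0) (msg_x (1 + 1)) in uv2 uv00.
set v1 := M (bot_v 0) (msg_x 1) in uv1 uv00.
(* By proportionality, [v2] times the decoded coefficient of x_1, which is 1, equals [v1] times that
   of x_2, which is 0. *)
have /eqP : v2 = 0; last by rewrite (negPf (v0 _ _)).
rewrite -[v2]mulr1 -uv1 mulrDr [v2 * (D t0 (bot_u 0) * _)]mulrCA.
by rewrite [v2 * M _ _]mulrC uv00 -[RHS](mulr0 v1) -[X in _ = v1 * X]uv2; ring.
Qed.

(* With [x = 1 + e] and [y = 1 + f] the difference [y * x - x * y] is an
   involution. *)
Lemma pappus_code_matrix_units (A : unitRingType) (e f : A) :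
  e * e = 0 -> f * f = 0 -> e * f + f * e = 1 -> pappus_code A.
Proof.
move=> ee ff efe.
have unip (h : A) : h * h = 0 -> 1 + h \is a GRing.unit.
  move=> hh; apply/unitrP; exists (1 - h).
  by rewrite mulrBl mulrBr !mulrDl !mulrDr !mul1r !mulr1 hh !addr0 !addrK.
pose a := (1 + e) * (1 + f); pose b := (1 + f) * (1 + e).
have ab : (b - a) * (b - a) = 1.
  have -> : b - a = f * e - e * f.
    rewrite /a /b !mulrDl !mulrDr !mul1r !mulr1 !addrA [1 + f + e]addrAC.
    by rewrite opprD addrACA subrr add0r.
  (* The cross terms vanish, so f e - e f and e f + f e have the same square. *)
  rewrite -[RHS](mulr1 1) -efe.
  have ef0 : e * f * (f * e) = 0 by rewrite -mulrA [f * _]mulrA ff mul0r mulr0.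
  have fe0 : f * e * (e * f) = 0 by rewrite -mulrA [e * _]mulrA ee mul0r mulr0.
  rewrite mulrBl !mulrBr !mulrDl !mulrDr ef0 fe0.
  by rewrite !subr0 !sub0r opprK addr0 add0r addrC.
(* Solving du + dv = 1 and du a + dv b = 0 gives dv = - a (b - a)^-1, and b - a is its own
   inverse. *)
apply: (@pappus_code_exists A (1 + e) (1 + f)
          (1 + a * (b - a)) (- (a * (b - a))) 0).
- exact: unip.
- exact: unip.
- by rewrite mul0rn addr0 addrK.
- rewrite -/a -/b mulrDl mul1r mulNr -addrA -mulrBr -mulrA.
  by rewrite -[a - b]opprB mulrN ab mulrN1 subrr.
- by rewrite mul0rn.
Qed.

End PappusNetwork.

(** * The network for a given set of primes *)

Theorem theorem1 (P : seq nat) (hP : P != [::]) (hprime : all prime P) :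
  exists N : network,
    [/\ network_wf N,
        (forall F : finFieldType,
            vlnc_solution N F 1 <-> exists2 p, p \in P & p \in [pchar F])
      & (forall F : finFieldType, vlnc_solution N F 2)].
Proof.
pose m := (\prod_(p <- P) p)%N.
have m_char (F : fieldType) :
    m%:R = 0 :> F <-> exists2 p, p \in P & p \in [pchar F].
  rewrite natr_prod; split=> [/eqP|[p pP /andP[_ p0]]].
    rewrite prodf_seq_eq0 => /hasP[p pP /= p0].
    by exists p; rewrite // inE (allP hprime) // p0.
  by apply/eqP; rewrite prodf_seq_eq0; apply/hasP; exists p.
exists (one_layer_network (@support m) (@received m) (@known m) (@demanded m)).
split=> [|F|F]; first exact: one_layer_network_wf.
- rewrite -m_char; split=> [/one_layer_networkP[M [D [MS MD]]]|m0].
    apply: (@pappus_code_char m F).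
    exists (fun b a => M b a 0 0), (fun t b => D t b 0 0).
    split=> [b a nS|t a nK]; first by rewrite MS // mxE.
    have /matrixP/(_ 0 0) := MD t a nK.
    rewrite summxE; under eq_bigr => b _ do rewrite mxE big_ord1.
    by move=> ->; case: (a == _); rewrite mxE.
  apply/one_layer_networkP.
  (* Here terminal (0, 0) ignores U_0 and V_0 and just adds up the e_k. *)
  apply: (@pappus_code_exists m _ 1 1 0 0 1); rewrite ?unitr1 //.
  + by rewrite !add0r mulrS -(rmorph_nat (@scalar_mx F 1)) m0 rmorph0 addr0.
  + by rewrite !mul0r addr0.
  + by rewrite -(rmorph_nat (@scalar_mx F 1)) m0 rmorph0.
- apply/one_layer_networkP.
  apply: (@pappus_code_matrix_units m _ (delta_mx 0 1) (delta_mx 1 0)).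
  + exact: mul_delta_mx_0.
  + exact: mul_delta_mx_0.
  + rewrite -[LHS]/(_ *m _ + _ *m _) !mul_delta_mx.
    by rewrite -[RHS]/1%:M mx1_sum_delta big_ord_recl big_ord1;
       congr (_ + delta_mx _ _); apply: val_inj.
Qed.
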